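(* Let $\mathbb K$ be a field of characteristic $0$, $\ell\ge2$, and let $(g;f_1,f_2,\ldots,f_\ell)=(d_{n,k})_{n\ge k\ge0}$ be an $\ell$-multiple Riordan array over $\mathbb K$ with $$g(t)=\sum_{k\ge0}g_kt^{k\ell},\qquad f_i(t)=\sum_{k\ge0}f_{i,k}t^{k\ell+1}\quad(i=1,\ldots,\ell).$$ Let its compression $(\hat d_{n,k})_{n\ge k\ge0}$ be defined by $\hat d_{n,k}=d_{n\ell-(\ell-1)k,\,k}$. Put $$\hat g(t)=\sum_{k\ge0}g_kt^k,\qquad \hat f_i(t)=\sum_{k\ge0}f_{i,k}t^{k+1}\quad(i=1,\ldots,\ell).$$ Then $\hat d_{n,0}=[t^n]\hat g(t)$, and for $n\ge k\ge1$, $$\hat d_{n,k}=\begin{cases}[t^n]\,\hat g\,(\hat f_1\hat f_2\cdots\hat f_\ell)^{k/\ell}, & k\equiv0\pmod\ell,\\[2pt] [t^n]\,\hat g\,\hat f_1\cdots\hat f_m(\hat f_1\hat f_2\cdots\hat f_\ell)^{(k-m)/\ell}, & k\equiv m\pmod\ell,\ 1\le m\le\ell-1.\end{cases}$$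
   Context: An $\ell$-multiple Riordan array $(g;f_1,\ldots,f_\ell)$ is given by $g\in\mathbb K[[t^\ell]]$ with $g(0)\neq0$ and $f_i\in t\,\mathbb K[[t^\ell]]$ with $[t]f_i\ne0$; it is the infinite lower triangular matrix with entries $$d_{n,k}=[t^n]\,g\,f_1^{\lfloor (k+\ell-1)/\ell\rfloor}f_2^{\lfloor (k+\ell-2)/\ell\rfloor}\cdots f_\ell^{\lfloor k/\ell\rfloor},$$ so successive columns have generating functions $g,gf_1,gf_1f_2,\ldots,gf_1\cdots f_\ell,gf_1^2f_2\cdots f_\ell,\ldots$. *)

(* Defs.v *)
From HB Require Import structures.
From mathcomp Require Import all_boot all_order all_algebra.
From mathcomp Require Import boolp.
Set Implicit Arguments.
Unset Strict Implicit.
Unset Printing Implicit Defensive.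
Import GRing.Theory.
Local Open Scope ring_scope.

(* R[[t]], as a record so that the Cauchy product is not confused with the    *)
(* pointwise product of functions nat -> R.                                   *)
Record fps (R : Type) : Type := Fps { fps_coefs : nat -> R }.

(* coeft n F is [t^n] F *)
Definition coeft (R : Type) (n : nat) (F : fps R) : R := fps_coefs F n.

Lemma fpsP (R : Type) (F G : fps R) :
  (forall n, coeft n F = coeft n G) -> F = G.
Proof. by case: F G => F [G] FG; congr Fps; apply/funext. Qed.

HB.instance Definition _ (R : Type) := gen_eqMixin (fps R).
HB.instance Definition _ (R : Type) := gen_choiceMixin (fps R).

Section FpsRing.
Variable R : comNzRingType.
Implicit Types F G H : fps R.

Definition fps_zero : fps R := Fps (fun=> 0).
Definition fps_opp F : fps R := Fps (fun n => - coeft n F).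
Definition fps_add F G : fps R := Fps (fun n => coeft n F + coeft n G).

Fact fps_addA : associative fps_add.
Proof. by move=> F G H; apply: fpsP => n; apply: addrA. Qed.
Fact fps_addC : commutative fps_add.
Proof. by move=> F G; apply: fpsP => n; apply: addrC. Qed.
Fact fps_add0 : left_id fps_zero fps_add.
Proof. by move=> F; apply: fpsP => n; apply: add0r. Qed.
Fact fps_addN : left_inverse fps_zero fps_opp fps_add.
Proof. by move=> F; apply: fpsP => n; apply: addNr. Qed.

HB.instance Definition _ :=
  GRing.isZmodule.Build (fps R) fps_addA fps_addC fps_add0 fps_addN.

Definition fps_one : fps R := Fps (fun n => (n == 0%N)%:R).
Definition fps_mul F G : fps R :=
  Fps (fun n => \sum_(i < n.+1) coeft i F * coeft (n - i) G).

Definition fps_trunc N F : {poly R} := \poly_(i < N) coeft i F.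

Lemma coef_fps_trunc N F n : (n < N)%N -> (fps_trunc N F)`_n = coeft n F.
Proof. by move=> nN; rewrite coef_poly nN. Qed.

Lemma fps_mul_trunc N F G n : (n < N)%N ->
  coeft n (fps_mul F G) = (fps_trunc N F * fps_trunc N G)`_n.
Proof.
move=> nN; rewrite coefM; apply: eq_bigr => i _.
rewrite !coef_fps_trunc ?(leq_ltn_trans (leq_subr _ _) nN) //.
by rewrite (leq_ltn_trans _ nN) // -ltnS.
Qed.

Fact fps_mulC : commutative fps_mul.
Proof.
by move=> F G; apply: fpsP => n; rewrite !(@fps_mul_trunc n.+1) // mulrC.
Qed.

Fact fps_mulA : associative fps_mul.
Proof.
move=> F G H; apply: fpsP => n; transitivity
  ((fps_trunc n.+1 F * (fps_trunc n.+1 G * fps_trunc n.+1 H))`_n).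
  rewrite coefM; apply: eq_bigr => i _; rewrite coef_fps_trunc //.
  by rewrite (@fps_mul_trunc n.+1) // ltnS leq_subr.
rewrite mulrA coefM; apply: eq_bigr => i _.
by rewrite (@fps_mul_trunc n.+1) // coef_fps_trunc // ltnS leq_subr.
Qed.

Fact fps_mul1 : left_id fps_one fps_mul.
Proof.
move=> F; apply: fpsP => n; rewrite /coeft /= big_ord_recl /= mul1r subn0.
by rewrite big1 ?addr0 // => i _; rewrite mul0r.
Qed.

Fact fps_mulD : left_distributive fps_mul fps_add.
Proof.
move=> F G H; apply: fpsP => n; rewrite /coeft /= -big_split /=.
by apply: eq_bigr => i _; rewrite mulrDl.
Qed.

Fact fps_one_neq0 : fps_one != 0.
Proof.
apply/eqP => /(congr1 (coeft 0%N)); rewrite /coeft /= => /eqP.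
by rewrite oner_eq0.
Qed.

HB.instance Definition _ := GRing.Zmodule_isComNzRing.Build (fps R)
  fps_mulA fps_mulC fps_mul1 fps_mulD fps_one_neq0.

Lemma coeftM n F G :
  coeft n (F * G) = \sum_(i < n.+1) coeft i F * coeft (n - i) G.
Proof. by []. Qed.

Definition fpsX : fps R := Fps (fun n => (n == 1%N)%:R).

(* The series \sum_(k >= 0) a_k t^(e k). The truncation of the sum at k <= n  *)
(* loses nothing only when k <= e k for all k; this holds for e k = k * l,    *)
(* k * l + 1 (with 0 < l) and k + 1.                                          *)
Definition fps_series (e : nat -> nat) (a : nat -> R) : fps R :=
  Fps (fun n => \sum_(k < n.+1 | e k == n) a k).

(* K[[t^l]], for 0 < l *)
Definition in_fps_pow (l : nat) (F : fps R) : Prop :=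
  exists a : nat -> R, F = fps_series (fun k => k * l)%N a.

End FpsRing.

(* f_1, ..., f_l are indexed from 0: f_(i+1) is f i, for i : 'I_l. *)
Record multiple_riordan (K : fieldType) (l : nat)
    (g : fps K) (f : 'I_l -> fps K) : Prop := MultipleRiordan {
  riordan_g_in : in_fps_pow l g;
  riordan_g_neq0 : coeft 0%N g != 0;
  riordan_f_in : forall i, exists2 h, in_fps_pow l h & f i = fpsX K * h;
  riordan_f_neq0 : forall i, coeft 1%N (f i) != 0 }.

(* The exponent of f_j is floor ((k + l - j) / l), with j = i + 1. *)
Definition riordan_array (K : fieldType) (l : nat)
    (g : fps K) (f : 'I_l -> fps K) (n k : nat) : K :=
  coeft n (g * \prod_(i < l) f i ^+ ((k + l - i.+1) %/ l)%N).

(* Only meaningful for k <= n, where the subtraction does not truncate. *)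
Definition compression (K : Type) (l : nat) (d : nat -> nat -> K)
    (n k : nat) : K :=
  d (n * l - (l - 1) * k)%N k.

(* Main.v *)
Require Import Defs.
From mathcomp Require Import all_boot all_order all_algebra.
From mathcomp Require Import zify.
Set Implicit Arguments.
Unset Strict Implicit.
Unset Printing Implicit Defensive.
Import GRing.Theory.
Local Open Scope ring_scope.

(** Every series involved has the form [F = t^c A(t^l)], and hatting it gives
    [t^c A(t)].  Since substituting [t^l] for [t] is multiplicative, this
    correspondence is compatible with products, the exponents [c] adding up.
    Column [k] of the array has [c = k], whence
    [[t^(n l - (l - 1) k)] t^k A(t^l) = [t^(n - k)] A = [t^n] t^k A]. *)

Section Expansion.
Variables (R : comNzRingType) (l : nat).
Hypothesis l_gt0 : (0 < l)%N.
Implicit Types (F G A B : fps R) (a : nat -> R).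

(** The substitution $A(t^l)$, given by its coefficients. *)
Definition fps_expand A : fps R :=
  Fps (fun n => if (l %| n)%N then coeft (n %/ l) A else 0).

Lemma coeft_expand_trunc N A n : (n < N)%N ->
  coeft n (fps_expand A) = (fps_trunc N A \Po 'X^l)`_n.
Proof.
move=> nN; rewrite coef_comp_poly_Xn // {1}/coeft /=; case: ifP => // _.
by rewrite coef_fps_trunc // (leq_ltn_trans (leq_div _ _)).
Qed.

(** Coefficients up to [n] depend only on truncations at [n.+1], where the substitution is
    composition with the polynomial ['X^l], a ring morphism. *)
Lemma fps_expandM A B : fps_expand (A * B) = fps_expand A * fps_expand B.
Proof.
apply: fpsP => n; transitivity
  (((fps_trunc n.+1 A * fps_trunc n.+1 B) \Po 'X^l)`_n).
  rewrite coef_comp_poly_Xn // {1}/coeft /=; case: ifP => // _.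
  by rewrite -(@fps_mul_trunc _ n.+1) // ltnS leq_div.
rewrite comp_polyM coefM coeftM; apply: eq_bigr => i _.
by rewrite !(@coeft_expand_trunc n.+1) // ltnS leq_subr.
Qed.

Lemma fps_expand1 : fps_expand 1 = 1.
Proof.
apply: fpsP => n; rewrite /coeft /= /coeft /=.
case: ifPn => [/dvdnP[q ->]|]; first by rewrite mulnK // muln_eq0 (gtn_eqF l_gt0) orbF.
by case: n => //; rewrite dvdn0.
Qed.

Lemma coeftXM0 F : coeft 0 (fpsX R * F) = 0.
Proof. by rewrite coeftM big_ord1 {1}/coeft /= mul0r. Qed.

Lemma coeftXMS n F : coeft n.+1 (fpsX R * F) = coeft n F.
Proof.
rewrite coeftM !big_ord_recl /= big1 => [|i _]; last by rewrite {1}/coeft /= mul0r.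
by rewrite {1 3}/coeft /= mul0r mul1r add0r addr0 subn1.
Qed.

Lemma coeftXnM k n F : coeft (k + n) (fpsX R ^+ k * F) = coeft n F.
Proof.
by elim: k => [|k IHk]; rewrite ?expr0 ?mul1r // exprS -mulrA addSn coeftXMS.
Qed.

Lemma fps_series_shift (e : nat -> nat) a : (forall k, k <= e k)%N ->
  fps_series (fun k => e k + 1)%N a = fpsX R * fps_series e a.
Proof.
move=> le_e; apply: fpsP => -[|n].
  by rewrite coeftXM0 /coeft /= big1 // => i; rewrite addn1.
rewrite coeftXMS /coeft /= big_mkcond big_ord_recr /= addn1 eqSS.
(* The left sum has one extra index, [n.+1]; it contributes nothing because [e n.+1 >= n.+1 > n]. *)
rewrite gtn_eqF ?le_e // addr0 [RHS]big_mkcond /=.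
by apply: eq_bigr => i _; rewrite addn1 eqSS.
Qed.

Lemma fps_series_id a : fps_series (fun k => k) a = Fps a.
Proof.
by apply: fpsP => n; rewrite /coeft /= (big_pred1 ord_max) // => i; apply/eqP/eqP => [/val_inj|->].
Qed.

Lemma fps_series_mul a : fps_series (fun k => k * l)%N a = fps_expand (Fps a).
Proof.
apply: fpsP => n; rewrite /coeft /=; case: ifPn => [/dvdnP[q ->]|ndvd].
  (* The one contributing index, [q], lies within the truncated sum because [q <= q * l]. *)
  have q_lt : (q < (q * l).+1)%N by rewrite ltnS leq_pmulr.
  rewrite mulnK // (big_pred1 (Ordinal q_lt)) // => i.
  by rewrite eqn_pmul2r.
by rewrite big_pred0 // => i; apply: contraNF ndvd => /eqP <-; apply: dvdn_mull.
Qed.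

(** The exponent [c] has to be recorded, since [F] alone does not determine [G]: $t^l$ corresponds
    to $t$ for $c = 0$ and to $t^l$ for $c = l$. *)
Definition dilation c F G :=
  exists2 A, F = fpsX R ^+ c * fps_expand A & G = fpsX R ^+ c * A.

Lemma dilationM c d F G F' G' : dilation c F G -> dilation d F' G' ->
  dilation (c + d) (F * F') (G * G').
Proof.
move=> [A -> ->] [B -> ->].
by exists (A * B); rewrite ?fps_expandM exprD mulrACA.
Qed.

Lemma dilation1 : dilation 0 1 1.
Proof. by exists 1; rewrite ?fps_expand1 expr0 mul1r. Qed.

Lemma dilationX q c F G : dilation c F G -> dilation (q * c) (F ^+ q) (G ^+ q).
Proof.
move=> FG; elim: q => [|q IHq]; first by rewrite !expr0; exact: dilation1.
by rewrite !exprS mulSn; apply: dilationM.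
Qed.

Lemma dilation_prod (I : finType) (P : pred I) (c : I -> nat) (F G : I -> fps R) :
  (forall i, dilation (c i) (F i) (G i)) ->
  dilation (\sum_(i | P i) c i) (\prod_(i | P i) F i) (\prod_(i | P i) G i).
Proof.
move=> FG; apply: (big_ind3 dilation) => //; first exact: dilation1.
by move=> *; apply: dilationM.
Qed.

Lemma dilation_series0 a :
  dilation 0 (fps_series (fun k => k * l)%N a) (fps_series (fun k => k) a).
Proof.
by exists (Fps a); rewrite expr0 mul1r (fps_series_mul, fps_series_id).
Qed.

Lemma dilation_series1 a :
  dilation 1 (fps_series (fun k => k * l + 1)%N a) (fps_series (fun k => k + 1)%N a).
Proof.
exists (Fps a); rewrite expr1 fps_series_shift ?fps_series_mul ?fps_series_id //.
by move=> k; rewrite leq_pmulr.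
Qed.

Lemma coeft_dilation k n F G : (k <= n)%N -> dilation k F G ->
  coeft (n * l - (l - 1) * k) F = coeft n G.
Proof.
move=> le_kn [A -> ->].
have -> : (n * l - (l - 1) * k = k + (n - k) * l)%N by nia.
rewrite -{2}(subnKC le_kn) !coeftXnM /coeft /=.
by rewrite dvdn_mull // mulnK.
Qed.

End Expansion.

(** After removal of $ql$, the remainder $m + l - i - 1$ lies in $[l, 2l)$ if $i < m$ and in $[0,
    l)$ otherwise. *)
Lemma divn_column (l q m i : nat) : (m < l)%N -> (i < l)%N ->
  ((q * l + m + l - i.+1) %/ l = q + (i < m))%N.
Proof.
move=> lt_ml lt_il; have l_gt0 : (0 < l)%N by lia.
case: ltnP => h; rewrite ?addn0 ?addn1.
  have -> : (q * l + m + l - i.+1 = q.+1 * l + (m - i.+1))%N by nia.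
  by rewrite divnMDl // divn_small ?addn0 //; lia.
have -> : (q * l + m + l - i.+1 = q * l + (m + l - i.+1))%N by nia.
by rewrite divnMDl // divn_small ?addn0 //; lia.
Qed.

(** Column $ql + m$ arises from [q] full rounds through the [l] series and one more factor from each
    of the first [m]. *)
Lemma prod_column (R : comNzRingType) (l q m : nat) (F : 'I_l -> R) : (m < l)%N ->
  \prod_(i < l) F i ^+ ((q * l + m + l - i.+1) %/ l)%N =
  \prod_(i < l | (i < m)%N) F i * (\prod_(i < l) F i) ^+ q.
Proof.
move=> lt_ml; rewrite -prodrXl [X in X * _]big_mkcond -big_split /=.
apply: eq_bigr => i _; rewrite divn_column // exprD mulrC.
by case: (i < m)%N.
Qed.

(** Both cases of the theorem at once: for [m = 0] the partial product is empty. *)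
Lemma compression_column (K : fieldType) (l : nat) (g ghat : fps K)
    (f fhat : 'I_l -> fps K) (n q m : nat) :
  (m < l)%N -> (q * l + m <= n)%N ->
  @dilation K l 0 g ghat -> (forall i, @dilation K l 1 (f i) (fhat i)) ->
  compression l (riordan_array g f) n (q * l + m) =
  coeft n (ghat * \prod_(i < l | (i < m)%N) fhat i * (\prod_(i < l) fhat i) ^+ q).
Proof.
move=> lt_ml le_kn dg df; have l_gt0 : (0 < l)%N by lia.
rewrite /compression /riordan_array prod_column // mulrA.
(* The exponent is split as [0 + m + q * l], matching [g], the partial product and the [q]-th
   power. *)
apply: coeft_dilation => //; rewrite addnC -[m]add0n.
apply: dilationM => //; last first.
  have := dilation_prod l_gt0 xpredT df.
  by rewrite sum1_card card_ord; apply: dilationX.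
apply: dilationM => //.
have := dilation_prod l_gt0 (fun i : 'I_l => i < m)%N df.
(* As [m <= l], exactly [m] indices below [l] satisfy [i < m], so the exponents add up to [m]. *)
rewrite -(big_ord_widen l (fun=> 1%N)) ?sum1_card ?card_ord //; exact: ltnW.
Qed.

Theorem theorem6p1 (K : fieldType) (charK0 : [pchar K] =i pred0)
  (l : nat) (hl : (2 <= l)%N)
  (g : fps K) (f : 'I_l -> fps K) (hgf : multiple_riordan g f)
  (g_ : nat -> K) (f_ : 'I_l -> nat -> K)
  (hg : g = fps_series (fun k => k * l)%N g_)
  (hf : forall i : 'I_l, f i = fps_series (fun k => k * l + 1)%N (f_ i)) :
  let dhat := compression l (riordan_array g f) in
  let ghat := fps_series (fun k => k) g_ in
  let fhat := fun i : 'I_l => fps_series (fun k => k + 1)%N (f_ i) in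
  (forall n : nat, dhat n 0%N = coeft n ghat) /\
  (forall n k : nat, (1 <= k <= n)%N ->
     (k = 0 %[mod l] ->
        dhat n k = coeft n (ghat * (\prod_(i < l) fhat i) ^+ (k %/ l)%N)) /\
     (forall m : nat, (1 <= m <= l - 1)%N -> k = m %[mod l] ->
        dhat n k = coeft n (ghat * \prod_(i < l | (i < m)%N) fhat i
                              * (\prod_(i < l) fhat i) ^+ ((k - m) %/ l)%N))).
Proof.
move=> dhat ghat fhat; have l_gt0 : (0 < l)%N by apply: ltnW.
have dg : @dilation K l 0 g ghat by rewrite hg; apply: dilation_series0.
have df i : @dilation K l 1 (f i) (fhat i) by rewrite hf; apply: dilation_series1.
have column n q m : (m < l)%N -> (q * l + m <= n)%N -> dhat n (q * l + m)%N = _ :=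
  fun lt_ml le_kn => compression_column lt_ml le_kn dg df.
split=> [n|n k /andP[_ le_kn]].
  by rewrite (column n 0 0)%N // big_pred0 // expr0 !mulr1.
split=> [k0|m /andP[_ lt_ml] km].
  have kE : k = (k %/ l * l + 0)%N by rewrite {1}(divn_eq k l) k0 mod0n.
  by rewrite {1}kE column -?kE // big_pred0 // mulr1.
have {}lt_ml : (m < l)%N by lia.
have kE : k = (k %/ l * l + m)%N by rewrite {1}(divn_eq k l) km modn_small.
(* The exponent [(k - m) %/ l] of the goal agrees with the quotient [k %/ l] supplied by [column],
   since [k - m] is [k %/ l * l]. *)
by rewrite {1}kE column -?kE // {2}kE addnK mulnK.
Qed.
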